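(* Let $\alpha\in[0,\pi/2)$ and let $A,B\in\mathbb{M}_n$ satisfy $W(A)\subset S_\alpha$ and $W(B)\subset S_\alpha$. Let $A$ and $B$ be conformally partitioned as $$A=\begin{bmatrix} A_{11} & A_{12}\\ A_{21} & A_{22}\end{bmatrix},\qquad B=\begin{bmatrix} B_{11} & B_{12}\\ B_{21} & B_{22}\end{bmatrix},$$ with square diagonal blocks ($A_{11}$ and $B_{11}$ having the same size). Then $$\sec^2(\alpha)\,\Re\Big((A+B)/(A_{11}+B_{11})\Big)\ \ge\ \Re(A/A_{11})+\Re(B/B_{11}).$$
   Context: $\mathbb{M}_n$ is the set of $n\times n$ complex matrices. For a square complex matrix $A$ with conjugate transpose $A^*$, $\Re A=\frac12(A+A^* )$. For Hermitian matrices $H,K$ of the same size, $H\ge K$ means $H-K$ is positive semidefinite. The numerical range is $W(A)=\{x^*Ax: x\in\mathbb{C}^n,\ x^*x=1\}$, and for $\alpha\in[0,\pi/2)$ the sector is $S_\alpha=\{z\in\mathbb{C}:\Re z>0,\ |\Im z|\le(\Re z)\tan\alpha\}$. If $A$ is partitioned into $2\times 2$ blocks with square diagonal blocks and $A_{11}$ is nonsingular, the Schur complement of $A_{11}$ in $A$ is $A/A_{11}=A_{22}-A_{21}A_{11}^{-1}A_{12}$; likewise $(A+B)/(A_{11}+B_{11})$ is the Schur complement of the $(1,1)$ block $A_{11}+B_{11}$ in $A+B$. (A matrix whose numerical range lies in $S_\alpha$ is nonsingular.) *)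

(* Defs.v *)
From mathcomp Require Import all_boot all_order all_algebra.
From mathcomp Require Import complex.
From mathcomp Require Import all_classical all_reals all_analysis.

Set Implicit Arguments.
Unset Strict Implicit.
Unset Printing Implicit Defensive.

Import Order.TTheory GRing.Theory Num.Theory.

Local Open Scope classical_set_scope.
Local Open Scope ring_scope.
Local Open Scope complex_scope.
Local Open Scope sesquilinear_scope.

Definition re_mx (R : realType) (n : nat) (A : 'M[R[i]]_n) : 'M[R[i]]_n :=
  2^-1 *: (A + A ^t*).

(* In the order of R[i], 0 <= z says that z is real and nonnegative. *)
Definition psdmx (R : realType) (n : nat) (H : 'M[R[i]]_n) : Prop :=
  H \is hermsymmx /\ forall x : 'cV[R[i]]_n, 0 <= (x ^t* *m H *m x) 0 0.

Definition loewner_le (R : realType) (n : nat) (K H : 'M[R[i]]_n) : Prop :=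
  psdmx (H - K).

Definition numerical_range (R : realType) (n : nat) (A : 'M[R[i]]_n) :
    set R[i] :=
  [set (x ^t* *m A *m x) 0 0 | x in [set x : 'cV[R[i]]_n | x ^t* *m x = 1%:M]].

Definition sector (R : realType) (alpha : R) : set R[i] :=
  [set z | 0 < complex.Re z /\
           `|complex.Im z| <= complex.Re z * tan alpha].

(* The Schur complement of the leading p x p block. invmx is total, so this is
   the usual notion only when ulsubmx A is invertible. *)
Definition schur_complement (R : realType) (p q : nat)
    (A : 'M[R[i]]_(p + q)) : 'M[R[i]]_q :=
  drsubmx A - dlsubmx A *m invmx (ulsubmx A) *m ursubmx A.

Definition sec (R : realType) (alpha : R) : R := (cos alpha)^-1.

(* Main.v *)
Require Import Defs.
From mathcomp Require Import all_boot all_order all_algebra.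
From mathcomp Require Import complex.
From mathcomp Require Import all_classical all_reals all_analysis.
From mathcomp Require Import ring lra.

(** Let S be the Schur complement A / A11. For a vector y, let u be the
    vector with lower part y and upper part - A11^-1 A12 y. Then A u has upper
    part 0 and lower part S y, so that for every w with the same lower part y,

      Re (w^* A u) = Re (y^* S y),                                         (1)

    and in particular Re (y^* S y) = Re (u^* A u).

    If W(A) lies in the sector of slope t = tan alpha, then A satisfies a
    Cauchy-Schwarz inequality with constant sqrt (1 + t^2) = sec alpha between
    the values x^* A y and the norm given by Re A. In the additive form

      2 Re (w^* A u) <= (1 + t^2) Re (w^* A w) + Re (u^* A u)

    ([sectorial_form_le]) it gives, by (1), an inequality for every w with
    lower part y ([schur_form_le]):

      Re (y^* S y) <= sec^2 alpha * Re (w^* A w).                          (2)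

    Now take for w the vector u of the matrix A + B. By (1) its form under
    A + B is exactly the form of the Schur complement of A + B at y
    ([schur_form_attained]), and it splits as the form of A at w plus the form
    of B at w. Adding (2) for A and for B at this common w gives the theorem. *)

Import Order.TTheory GRing.Theory Num.Theory.

Local Open Scope classical_set_scope.
Local Open Scope ring_scope.
Local Open Scope complex_scope.
Local Open Scope sesquilinear_scope.

(** * The real bilinear form Re (x^* A y) *)

(** Only the real part is kept: [re_form_iE] below recovers the imaginary part
    as the value at 'i *: x, so that the whole proof takes place in R. *)
Definition re_form {R : realType} {n : nat} (A : 'M[R[i]]_n)
    (x y : 'cV[R[i]]_n) : R :=
  complex.Re ((x ^t* *m A *m y) 0 0).

Lemma ReD (R : realType) (z w : R[i]) :
  complex.Re (z + w) = complex.Re z + complex.Re w.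
Proof. by case: z w => [a b] [c d]. Qed.

Lemma ReN (R : realType) (z : R[i]) : complex.Re (- z) = - complex.Re z.
Proof. by case: z. Qed.

Lemma ReZ (R : realType) (c : R) (z : R[i]) :
  complex.Re (c%:C * z) = c * complex.Re z.
Proof. by case: z => a b /=; rewrite mul0r subr0. Qed.

Lemma ImZ (R : realType) (c : R) (z : R[i]) :
  complex.Im (c%:C * z) = c * complex.Im z.
Proof. by case: z => a b /=; rewrite mul0r addr0. Qed.

Lemma conjE (R : realType) (z : R[i]) : Num.conj z = conjc z.
Proof. by []. Qed.

Lemma conj_real (R : realType) (c : R) : Num.conj c%:C = c%:C.
Proof. by rewrite conjE /= oppr0. Qed.

Section Adjoint.
Context {R : realType}.

Lemma adjD m n (X Y : 'M[R[i]]_(m, n)) : (X + Y) ^t* = X ^t* + Y ^t*.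
Proof. by rewrite linearD map_mxD. Qed.

Lemma adjB m n (X Y : 'M[R[i]]_(m, n)) : (X - Y) ^t* = X ^t* - Y ^t*.
Proof. by rewrite linearB map_mxB. Qed.

Lemma adjZ m n (c : R[i]) (X : 'M[R[i]]_(m, n)) :
  (c *: X) ^t* = Num.conj c *: X ^t*.
Proof. by rewrite linearZ map_mxZ. Qed.

Lemma adjM m n p (X : 'M[R[i]]_(m, n)) (Y : 'M[R[i]]_(n, p)) :
  (X *m Y) ^t* = Y ^t* *m X ^t*.
Proof. by rewrite trmx_mul map_mxM. Qed.

Lemma adjK m n (X : 'M[R[i]]_(m, n)) : (X ^t*) ^t* = X.
Proof. by apply/matrixP => i j; rewrite !mxE conjCK. Qed.

Lemma adj_col_mx p q n (X : 'M[R[i]]_(p, n)) (Y : 'M[R[i]]_(q, n)) :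
  (col_mx X Y) ^t* = row_mx (X ^t*) (Y ^t*).
Proof. by rewrite tr_col_mx map_row_mx. Qed.

End Adjoint.

Section RealForm.
Context {R : realType} {n : nat}.
Implicit Types (A B : 'M[R[i]]_n) (x y z : 'cV[R[i]]_n) (c : R).

Lemma re_formDl A x y z : re_form A (x + y) z = re_form A x z + re_form A y z.
Proof. by rewrite /re_form adjD !mulmxDl mxE ReD. Qed.

Lemma re_formDr A x y z : re_form A x (y + z) = re_form A x y + re_form A x z.
Proof. by rewrite /re_form mulmxDr mxE ReD. Qed.

Lemma re_formDm A B x y : re_form (A + B) x y = re_form A x y + re_form B x y.
Proof. by rewrite /re_form mulmxDr mulmxDl mxE ReD. Qed.

Lemma re_formBm A B x y : re_form (A - B) x y = re_form A x y - re_form B x y.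
Proof. by rewrite /re_form mulmxBr mulmxBl !mxE ReD ReN. Qed.

Lemma re_formZl A c x y : re_form A (c%:C *: x) y = c * re_form A x y.
Proof. by rewrite /re_form adjZ conj_real -!scalemxAl mxE ReZ. Qed.

Lemma re_formZr A c x y : re_form A x (c%:C *: y) = c * re_form A x y.
Proof. by rewrite /re_form -scalemxAr mxE ReZ. Qed.

Lemma re_formZm A c x y : re_form (c%:C *: A) x y = c * re_form A x y.
Proof. by rewrite /re_form -scalemxAr -scalemxAl mxE ReZ. Qed.

Lemma re_form_iE A x y :
  re_form A ('i *: x) y = complex.Im ((x ^t* *m A *m y) 0 0).
Proof.
rewrite /re_form adjZ -!scalemxAl mxE conjE; case: (X in _ * X) => a b /=.
by rewrite !mul0r mulN1r sub0r opprK.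
Qed.

Lemma re_form_ir A x y : re_form A x ('i *: y) = - re_form A ('i *: x) y.
Proof.
rewrite re_form_iE /re_form -scalemxAr mxE; case: (X in _ * X) => a b /=.
by rewrite mul0r mul1r sub0r.
Qed.

Lemma re_form_ii A x y : re_form A ('i *: x) ('i *: y) = re_form A x y.
Proof.
rewrite re_form_iE /re_form -scalemxAr mxE; case: (X in _ * X) => a b /=.
by rewrite mul0r mul1r add0r.
Qed.

Lemma re_form_adj A x y : re_form (A ^t*) x y = re_form A y x.
Proof.
rewrite /re_form.
have -> : x ^t* *m A ^t* *m y = (y ^t* *m A *m x) ^t*.
  by rewrite !adjM adjK mulmxA.
by rewrite !mxE conjE; case: (X in _ X^*) => a b.
Qed.

Lemma re_form0 A x : re_form A x 0 = 0.
Proof. by rewrite /re_form mulmx0 mxE. Qed.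

End RealForm.

(** * Sectorial matrices *)

Definition accretive {R : realType} {n : nat} (A : 'M[R[i]]_n) : Prop :=
  forall x, x != 0 -> 0 < re_form A x x.

(** This is the homogeneous form of the condition on the numerical range: it
    can be used at the unnormalized vectors that the proof builds. *)
Definition sectorial {R : realType} {n : nat} (t : R) (A : 'M[R[i]]_n) :
    Prop :=
  accretive A /\
  forall x, `|re_form A ('i *: x) x| <= re_form A x x * t.

(** Arithmetic tactics compare atoms up to conversion, which unfolds matrix
    products; replacing the values of the forms by variables avoids this. *)
Ltac generalize_forms :=
  repeat match goal with
  | |- context [re_form ?A ?x ?y] => generalize (re_form A x y)
  end.

Section Accretive.
Context {R : realType}.

Lemma accretive_ge0 n (A : 'M[R[i]]_n) x : accretive A -> 0 <= re_form A x x.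
Proof.
move=> accA; have [->|/accA/ltW//] := eqVneq x 0; by rewrite re_form0.
Qed.

Lemma accretiveD n (A B : 'M[R[i]]_n) :
  accretive A -> accretive B -> accretive (A + B).
Proof. by move=> a b x x0; rewrite re_formDm addr_gt0 ?a ?b. Qed.

Lemma accretive_unitmx n (A : 'M[R[i]]_n) : accretive A -> A \in unitmx.
Proof.
move=> accA; rewrite -unitmx_tr unitmxE unitfE; apply/negP => /det0P[v v0 vA].
have /accA : v^T != 0 by rewrite trmx_eq0.
rewrite /re_form -mulmxA; suff -> : A *m v^T = 0 by rewrite mulmx0 mxE ltxx.
by apply: trmx_inj; rewrite trmx_mul trmxK vA trmx0.
Qed.

Lemma re_form_re_mx n (A : 'M[R[i]]_n) x : re_form (re_mx A) x x = re_form A x x.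
Proof.
rewrite /re_mx; have -> : 2^-1 = (2^-1 : R)%:C :> R[i].
  by rewrite fmorphV rmorph_nat.
by rewrite re_formZm re_formDm re_form_adj; field.
Qed.

(** Both sector conditions are invariant under positive scaling, and a nonzero
    vector is a positive multiple of a unit one. *)
Lemma numerical_range_sectorial n (A : 'M[R[i]]_n) (alpha : R) :
  numerical_range A `<=` sector alpha -> sectorial (tan alpha) A.
Proof.
move=> WA.
have key x : x != 0 -> 0 < re_form A x x /\
    `|re_form A ('i *: x) x| <= re_form A x x * tan alpha.
  move=> x0; rewrite re_form_iE /re_form.
  set s := \sum_i (complex.Re (x i 0) ^+ 2 + complex.Im (x i 0) ^+ 2).
  have term_ge0 i : 0 <= complex.Re (x i 0) ^+ 2 + complex.Im (x i 0) ^+ 2.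
    by rewrite addr_ge0 ?sqr_ge0.
  have s_gt0 : 0 < s.
    rewrite lt_neqAle sumr_ge0 // andbT eq_sym psumr_eq0 //.
    apply: contra x0 => /allP xi0; apply/eqP/matrixP => i j; rewrite !ord1 mxE.
    have := xi0 i (mem_index_enum _).
    rewrite /= paddr_eq0 ?sqr_ge0 // !sqrf_eq0 => /andP[/eqP r0 /eqP i0].
    by apply/eqP; rewrite eq_complex r0 i0 eqxx.
  have xx : x ^t* *m x = (s%:C)%:M.
    apply/matrixP => i j; rewrite !ord1 !mxE eqxx mulr1n /s rmorph_sum /=.
    apply: eq_bigr => k _; rewrite !mxE conjE; case: (x k 0) => a b.
    by apply/eqP; rewrite eq_complex /=; apply/andP; split; apply/eqP; ring.
  pose r := (Num.sqrt s)^-1.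
  have r2 : r * r = s^-1 by rewrite -invfM -expr2 sqr_sqrtr // ltW.
  have sv_gt0 : 0 < s^-1 by rewrite invr_gt0.
  have rx : (r%:C *: x) ^t* = r%:C *: x ^t* by rewrite adjZ conj_real.
  have [] : sector alpha (((r%:C *: x) ^t* *m A *m (r%:C *: x)) 0 0).
    apply: WA; exists (r%:C *: x) => //=.
    rewrite rx -scalemxAr -scalemxAl xx !scale_scalar_mx mulrA -!rmorphM /=.
    by rewrite r2 mulVf ?gt_eqF.
  rewrite rx -scalemxAr -!scalemxAl scalerA mxE -rmorphM /= r2 ReZ ImZ.
  rewrite normrM gtr0_norm // -mulrA ler_pM2l // pmulr_rgt0 //.
split=> [x /key[]//|x]; have [->|/key[]//] := eqVneq x 0.
by rewrite !re_form0 mul0r normr0.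
Qed.

(** Let H be the Hermitian part of A and K = A - H. With l = H^-1 K u one has
    w^* A u = w^* H (u + l), so Cauchy-Schwarz for H bounds Re (w^* A u) by the
    H-norms of w and u + l. As K is skew-Hermitian, u and l are orthogonal for
    the real part of H, so the squared norm of u + l is the sum of those of u
    and l. The sector condition gives |l|^2 <= t^2 |u|^2, whence the constant
    1 + t^2. *)
Lemma sectorial_form_le n (A : 'M[R[i]]_n) (t : R) u w : 0 <= t ->
  sectorial t A ->
  2 * re_form A w u <= (1 + t ^+ 2) * re_form A w w + re_form A u u.
Proof.
move=> t0 [accA secA].
have a_ge0 x : 0 <= re_form A x x by apply: accretive_ge0.
have ReA_unit : A + A ^t* \in unitmx.
  apply: accretive_unitmx => x x0; rewrite re_formDm re_form_adj.
  by rewrite addr_gt0 ?accA.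
have [l lE] : exists l, forall x,
    re_form A x l + re_form A l x = re_form A x u - re_form A u x.
  exists (invmx (A + A ^t*) *m ((A - A ^t*) *m u)) => x.
  set l := invmx _ *m _.
  rewrite -(re_form_adj A x l) -(re_form_adj A x u) -!re_formDm.
  rewrite /re_form /l -[in LHS]mulmxA mulKVmx // mulmxBl mulmxBr !mulmxA.
  by rewrite !mxE ReD ReN.
(* The sector condition at the two vectors l + 'i s u and l - 'i s u, used in
   opposite directions: what is left is the cross term 4 s |l|^2. *)
have cross s :
    2 * s * re_form A l l <= t * (re_form A l l + s ^+ 2 * re_form A u u).
  have bound s' : `|re_form A ('i *: l) l - s' ^+ 2 * re_form A u ('i *: u)
        + s' * (re_form A l u - re_form A u l)| <=
      (re_form A l l + s' ^+ 2 * re_form A u u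
        + s' * (re_form A l ('i *: u) + re_form A ('i *: u) l)) * t.
    pose v := l + s'%:C *: ('i *: u).
    have iv : 'i *: v = 'i *: l + (- s')%:C *: u.
      rewrite scalerDr !scalerA [_ * s'%:C]mulrC -mulrA -expr2 sqr_i.
      by rewrite rmorphN mulrN1.
    have := secA v; rewrite iv; congr (`|_| <= _ * _).
      rewrite !(re_formDl, re_formDr, re_formZl, re_formZr) !re_form_ii.
      by generalize_forms; clear => *; ring.
    rewrite !(re_formDl, re_formDr, re_formZl, re_formZr) !re_form_ii.
    by generalize_forms; clear => *; ring.
  have := bound s; have := bound (- s); have := congr1 ( *%R s) (lE l).
  by rewrite !ler_norml; generalize_forms; clear -s t => *; lra.
(* The best s is t; for t = 0 any positive s gives l = 0. *)
have l_le : re_form A l l <= t ^+ 2 * re_form A u u.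
  have [t_eq0|t_neq0] := eqVneq t 0.
    by have := cross 1; rewrite t_eq0; generalize_forms; clear -R => *; lra.
  have tpos : 0 < t by rewrite lt_neqAle eq_sym t_neq0.
  rewrite -(ler_pM2l tpos); have := cross t.
  by generalize_forms; clear -t => *; lra.
(* Cauchy-Schwarz: the H-norm of w - c (u + l) is nonnegative, and
   c = 1 / (1 + t^2) makes the term in c^2 at most c |u|^2. *)
have [c c_gt0 cE] : exists2 c : R, 0 < c & c * (1 + t ^+ 2) = 1.
  have t2_gt0 : 0 < 1 + t ^+ 2 by rewrite ltr_pwDl ?sqr_ge0.
  by exists (1 + t ^+ 2)^-1; rewrite ?invr_gt0 // mulVf ?gt_eqF.
have lu : re_form A u l + re_form A l u = 0 by rewrite lE subrr.
have quad_ge0 : 0 <= re_form A w w - 2 * c * re_form A w u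
    + c ^+ 2 * (re_form A u u + re_form A l l).
  have := congr1 ( *%R (c ^+ 2)) lu; have := congr1 ( *%R c) (lE w).
  have := a_ge0 (w + (- c)%:C *: (u + l)).
  rewrite !(re_formDl, re_formDr, re_formZl, re_formZr).
  by generalize_forms; clear -c t => *; lra.
have norm_le : c ^+ 2 * (re_form A u u + re_form A l l) <= c * re_form A u u.
  have := congr1 (fun e => c * e * re_form A u u) cE.
  have := l_le; rewrite -(ler_pM2l (mulr_gt0 c_gt0 c_gt0)).
  by generalize_forms; clear -c t => *; lra.
rewrite -(ler_pM2l c_gt0).
have := congr1 (fun e => e * re_form A w w) cE.
by move: quad_ge0 norm_le; generalize_forms; clear -c t => *; lra.
Qed.

End Accretive.

(** * Schur complements *)

(** The lift of y on which the upper part of A x vanishes. *)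
Definition schur_vec {R : realType} {p q : nat} (A : 'M[R[i]]_(p + q))
    (y : 'cV[R[i]]_q) : 'cV[R[i]]_(p + q) :=
  col_mx (- (invmx (ulsubmx A) *m ursubmx A *m y)) y.

Section Schur.
Context {R : realType} {p q : nat}.
Implicit Type A : 'M[R[i]]_(p + q).

Lemma accretive_ulsubmx A : accretive A -> accretive (ulsubmx A).
Proof.
move=> accA x x0.
have /accA : col_mx x 0 != 0 :> 'cV_(p + q).
  by rewrite col_mx_eq0 negb_and x0.
rewrite /re_form -{1}[A]submxK adj_col_mx -mulmxA mul_block_col mul_row_col.
by rewrite !mulmx0 !addr0 linear0 map_mx0 mul0mx addr0 mulmxA.
Qed.

(** As A times the lift of y is zero in its upper part, the value is
    independent of z. *)
Lemma re_form_schur A z y : ulsubmx A \in unitmx ->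
  re_form A (col_mx z y) (schur_vec A y)
    = re_form (schur_complement A) y y.
Proof.
move=> uA; rewrite /re_form -{1}[A]submxK adj_col_mx -mulmxA mul_block_col.
rewrite mul_row_col !mulmxN !mulmxA mulmxV // mul1mx addNr mulmx0 add0r.
by rewrite /schur_complement -[in RHS]mulmxA mulmxBl addrC -!mulmxA.
Qed.

(** The minimum over z of the right-hand form is the form of the Schur
    complement of Re A at y, so that this is the known bound of Re (A / A11) by
    sec^2 alpha times (Re A) / (Re A11). A bound for every z is easier to use,
    as the same z can serve for A and for B. *)
Lemma schur_form_le A (t : R) z y : 0 <= t -> sectorial t A ->
  re_form (schur_complement A) y y
    <= (1 + t ^+ 2) * re_form A (col_mx z y) (col_mx z y).
Proof.
move=> t0 sA; have uA := accretive_unitmx _ _ (accretive_ulsubmx A (proj1 sA)).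
have := sectorial_form_le _ A t (schur_vec A y) (col_mx z y) t0 sA.
rewrite [re_form A (schur_vec _ _) _]re_form_schur // re_form_schur //.
generalize_forms; clear -t => *; lra.
Qed.

(** At the lift of y the bound of [schur_form_le] is an equality with constant
    1. *)
Lemma schur_form_attained A y : accretive A ->
  exists z, re_form (schur_complement A) y y
              = re_form A (col_mx z y) (col_mx z y).
Proof.
move=> accA; have uA := accretive_unitmx _ _ (accretive_ulsubmx A accA).
exists (- (invmx (ulsubmx A) *m ursubmx A *m y)).
by rewrite -(re_form_schur A (- (invmx (ulsubmx A) *m ursubmx A *m y)) y uA).
Qed.

End Schur.

(** * The Loewner order *)

(** The value of a Hermitian H at x is real: the form of H takes values that
    are both equal and opposite at ('i *: x, x) and (x, 'i *: x). *)
Lemma psdmx_hermitian (R : realType) n (H : 'M[R[i]]_n) :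
  H ^t* = H -> (forall x, 0 <= re_form H x x) -> psdmx H.
Proof.
move=> herm pos; split=> [|x].
  by apply/is_hermitianmxP; rewrite expr0 scale1r.
rewrite lecE pos andbT /= -re_form_iE.
have := re_form_ir H x x; rewrite -{1}herm re_form_adj => /eqP.
by rewrite -addr_eq0 -mulr2n mulrn_eq0.
Qed.

Lemma adj_re_mx (R : realType) n (A : 'M[R[i]]_n) : (re_mx A) ^t* = re_mx A.
Proof.
by rewrite /re_mx adjZ adjD adjK addrC fmorphV rmorph_nat.
Qed.

Lemma loewner_le_re_mx (R : realType) n (c : R) (S T U : 'M[R[i]]_n) :
  (forall y, re_form S y y + re_form T y y <= c * re_form U y y) ->
  loewner_le (re_mx S + re_mx T) (c%:C *: re_mx U).
Proof.
move=> le_form; apply: psdmx_hermitian => [|y].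
  by rewrite adjB adjZ conj_real adjD !adj_re_mx.
by rewrite re_formBm re_formZm re_formDm !re_form_re_mx subr_ge0.
Qed.

Theorem theorem3p1 (R : realType) (alpha : R) (p q : nat)
    (A B : 'M[R[i]]_(p + q)) :
  0 <= alpha < pi / 2 ->
  numerical_range A `<=` sector alpha ->
  numerical_range B `<=` sector alpha ->
  loewner_le (re_mx (schur_complement A) + re_mx (schur_complement B))
             ((sec alpha ^+ 2)%:C *: re_mx (schur_complement (A + B))).
Proof.
move=> /andP[a0 a1] /numerical_range_sectorial sA /numerical_range_sectorial sB.
have cos0 : 0 < cos alpha.
  rewrite cos_gt0_pihalf // a1 (lt_le_trans _ a0) // oppr_lt0.
  by rewrite divr_gt0 ?pi_gt0.
have sec2 : sec alpha ^+ 2 = 1 + tan alpha ^+ 2.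
  by rewrite /sec exprVn cos2_tan2 ?gt_eqF.
have t0 : 0 <= tan alpha.
  rewrite /tan divr_ge0 ?(ltW cos0) // sin_ge0_pi // a0 (le_trans (ltW a1)) //.
  by have := pi_gt0 R; lra.
rewrite sec2; apply: loewner_le_re_mx => y.
have accAB : accretive (A + B) by apply: accretiveD; [case: sA|case: sB].
have [z ->] := schur_form_attained (A + B) y accAB.
rewrite re_formDm.
have := schur_form_le A (tan alpha) z y t0 sA.
have := schur_form_le B (tan alpha) z y t0 sB.
generalize_forms; clear -alpha => *; lra.
Qed.
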